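(* Let $G$ be a group and $T$ a type of algebras. Each $(\theta,\mathcal A)\in\mathsf{pA}(G,\mathsf{Al}(T))$ admits a globalization in $\mathsf A(G,\mathsf{Al}(T))$. Moreover, $(\boldsymbol\theta^{\mathbf U},\mathcal W(\mathcal A^U))$, with the map $a\mapsto[1,a]_\Theta$, is a universal globalization of $(\theta,\mathcal A)$ in $\mathsf A(G,\mathsf{Al}(T))$.
   Context: Partial actions. A partial action of a group $G$ on a set $A$ is a partial map $\theta:G\times A\dashrightarrow A$ such that for all $x,y\in G$, $a\in A$: (i) $\theta(1,a)$ is defined and equals $a$; (ii) if $\theta(x,a)$ is defined, then $\theta(x^{-1},\theta(x,a))$ is defined and equals $a$; (iii) if $\theta(y,a)$ and $\theta(x,\theta(y,a))$ are defined, then $\theta(xy,a)$ is defined and equals $\theta(x,\theta(y,a))$. It is global if everywhere defined. One writes $xa$ for $\theta(x,a)$ and $xa\neq\varnothing$ for ''$xa$ is defined''. The domain $D_x$ is $\{\theta(x,a)\mid a\in A,\ \theta(x,a)\text{ defined}\}$, and $\theta_x=\theta(x,-)$ is a bijection $D_{x^{-1}}\to D_x$. A type of algebras is a sequence $T=\{n_\gamma\}_{\gamma<o(T)}$ of non-negative integers indexed by ordinals; $\mathsf{Al}(T)$ is the category of (total) algebras of type $T$ with operations $f_\gamma$ of arity $n_\gamma$. A partial algebra of type $T$ is a set with partial operations $f_\gamma$ of arity $n_\gamma$. $\mathsf{pA}(G,\mathsf{Al}(T))$ is the category of pairs $(\theta,\mathcal A)$ with $\mathcal A\in\mathsf{Al}(T)$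 and $\theta$ a partial action of $G$ on the set $A$ such that every $D_x$ is a subalgebra $\mathcal D_x$ of $\mathcal A$ and every $\theta_x:\mathcal D_{x^{-1}}\to\mathcal D_x$ is an isomorphism. Morphisms $(\theta,\mathcal A)\to(\theta',\mathcal A')$ are homomorphisms $\varphi$ such that whenever $\theta(x,a)$ is defined, $\theta'(x,\varphi(a))$ is defined and equals $\varphi(\theta(x,a))$. $\mathsf A(G,\mathsf{Al}(T))$ is the full subcategory of pairs with global $\theta$. Globalization. A globalization of $(\theta,\mathcal A)$ in $\mathsf A(G,\mathsf{Al}(T))$ is $(\vartheta,\mathcal B)\in\mathsf A(G,\mathsf{Al}(T))$ with an injective morphism $\iota:(\theta,\mathcal A)\to(\vartheta,\mathcal B)$ such that $xa\neq\varnothing\iff x\iota(a)\in\iota(A)$ for all $x\in G$, $a\in A$. It is universal if for any globalization $\iota':(\theta,\mathcal A)\to(\vartheta',\mathcal B')$ in $\mathsf A(G,\mathsf{Al}(T))$ there is a unique morphism $\kappa:(\vartheta,\mathcal B)\to(\vartheta',\mathcal B')$ with $\iota'=\kappa\circ\iota$. The partial algebra $\mathcal A^U$. $A^U=(G\times A)/{\sim}$, where $(x,a)\sim(y,b)$ iff $(y^{-1}x)a$ is defined and equals $b$; $[x,a]$ is the class of $(x,a)$; $\theta^U$ is the global action $x[y,a]=[xy,a]$. $\mathcal A^U$ is the partial algebra on $A^U$ with $f_\gamma([x,a_1],\dots,[x,a_{n_\gamma}])=[x,f_\gamma(a_1,\dots,a_{n_\gamma})]$ for $x\in G$, $a_i\in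 A$, and $f_\gamma$ undefined on tuples not of this form (for $n_\gamma=0$, $f_\gamma=[1,f_\gamma]$); this is well defined. Words. For a set $X$, $\mathcal W(X)$ (with underlying set $W(X)$) is the free algebra of type $T$ over $X$: its elements (words) are the formal terms built from letters $x\in X$ and the operation symbols $f_\gamma$. $\overline{\theta^U}$ is the action of $G$ on $\mathcal W(A^U)$ which applies $\theta^U(x,-)$ to each letter of a word. The algebra $\mathcal W(\mathcal C)$ for a partial algebra $\mathcal C$ with underlying set $C$. The value $v(w)\in C$ of $w\in W(C)$ (possibly undefined) is obtained by evaluating: $v(c)=c$ for a letter $c$; $v(f_\gamma(w_1,\dots,w_{n_\gamma}))=(f_\gamma)_{\mathcal C}(v(w_1),\dots,v(w_{n_\gamma}))$ if all $v(w_i)$ and the right-hand side are defined, and is undefined otherwise. The congruence $\Theta$ on $\mathcal W(C)$ is defined recursively: $(w,w')\in\Theta$ iff either $v(w),v(w')$ are defined and equal, or $w=f_\gamma(w_1,\dots,w_{n_\gamma})$, $w'=f_\gamma(w_1',\dots,w_{n_\gamma}')$ with $(w_i,w_i')\in\Theta$ for all $i$. $[w]_\Theta$ is the class of $w$, and $\mathcal W(\mathcal C)=\mathcal W(C)/\Theta$. Here this is applied to $\mathcal C=\mathcal A^U$; $[1,a]_\Theta$ is the class of the one-letter word $[1,a]$, and $\boldsymbol\theta^{\mathbf U}$ is the (well-defined) action of $G$ on $\mathcal W(\mathcal A^U)$ given by $\boldsymbol\theta^{\mathbf U}(x,[w]_\Theta)=[\overline{\theta^U}(x,w)]_\Theta$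 for $w\in W(A^U)$. *)

(* Defs.v *)
From HB Require Import structures.
From mathcomp Require Import all_boot.
From mathcomp Require Import boolp classical_sets.

Set Implicit Arguments.
Unset Strict Implicit.
Unset Printing Implicit Defensive.

Local Open Scope group_scope.
Local Open Scope classical_set_scope.
Local Open Scope quotient_scope.

(* The paper indexes operation symbols by the ordinals below [o(T)]; the
   well-order is never used, so an arbitrary index type is allowed here. *)
Record algtype := AlgType { symbol : Type; arity : symbol -> nat }.

(* The n-tuples over A are the functions ['I_n -> A], and partial maps into A
   are functions into [option A], [None] standing for "undefined". *)
Structure algebra (T : algtype) := Algebra {
  carrier :> Type;
  op : forall s : symbol T, ('I_(arity s) -> carrier) -> carrier }.

Structure palgebra (T : algtype) := PAlgebra {
  pcarrier :> Type;
  pop : forall s : symbol T, ('I_(arity s) -> pcarrier) -> option pcarrier }.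

Section PartialActions.
Variables (G : groupType) (T : algtype).

Record partial_action (A : Type) (theta : G -> A -> option A) : Prop := {
  pact1 : forall a, theta 1 a = Some a;
  pactK : forall x a b, theta x a = Some b -> theta x^-1 b = Some a;
  pactM : forall x y a b c,
    theta y a = Some b -> theta x b = Some c -> theta (x * y) a = Some c }.

Definition is_global (A : Type) (theta : G -> A -> option A) : Prop :=
  forall x a, exists b, theta x a = Some b.

Definition dom (A : Type) (theta : G -> A -> option A) (x : G) : set A :=
  [set b | exists a, theta x a = Some b].

Definition subalgebra (A : algebra T) (D : set A) : Prop :=
  forall (s : symbol T) (a : 'I_(arity s) -> A),
    (forall i, D (a i)) -> D (op a).

(* [g] is an isomorphism from the subalgebra D onto the subalgebra E. *)
Record subalgebra_iso (A : algebra T) (D E : set A) (g : A -> option A) :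
    Prop := {
  siso_dom : forall a, D a <-> exists b, g a = Some b;
  siso_cod : forall a b, g a = Some b -> E b;
  siso_inj : forall a a' b, g a = Some b -> g a' = Some b -> a = a';
  siso_surj : forall b, E b -> exists a, g a = Some b;
  siso_hom : forall (s : symbol T) (a b : 'I_(arity s) -> A),
    (forall i, g (a i) = Some (b i)) -> g (op a) = Some (op b) }.

Structure algact := AlgAct {
  underlying :> algebra T;
  act : G -> underlying -> option underlying }.

Record in_pA (X : algact) : Prop := {
  pA_action : partial_action (@act X);
  pA_sub : forall x, subalgebra (dom (@act X) x);
  pA_iso : forall x,
    subalgebra_iso (dom (@act X) x^-1) (dom (@act X) x) (@act X x) }.

Structure pA := PA { pA_algact :> algact; pAP : in_pA pA_algact }.

Definition in_A (X : algact) : Prop := in_pA X /\ is_global (@act X).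

Record morphism (X Y : algact) (phi : X -> Y) : Prop := {
  mor_hom : forall (s : symbol T) (a : 'I_(arity s) -> X),
    phi (op a) = op (fun i => phi (a i));
  mor_act : forall x a b, act x a = Some b -> act x (phi a) = Some (phi b) }.

Record globalization (X Y : algact) (iota : X -> Y) : Prop := {
  glob_in_A : in_A Y;
  glob_mor : morphism iota;
  glob_inj : injective iota;
  glob_act : forall x a,
    (exists b, act x a = Some b) <->
    (exists b, act x (iota a) = Some (iota b)) }.

Definition universal_globalization (X Y : algact) (iota : X -> Y) : Prop :=
  globalization iota /\
  forall (Y' : algact) (iota' : X -> Y'), globalization iota' ->
    exists! kappa : Y -> Y', morphism kappa /\ iota' = kappa \o iota.

End PartialActions.

Section ClassicalQuotient.
Variables (U : Type) (R : U -> U -> Prop).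
Hypothesis Rxx : forall x, R x x.
Hypothesis Rsym : forall x y, R x y -> R y x.
Hypothesis Rtrans : forall x y z, R x y -> R y z -> R x z.

Let r : rel {classic U} := fun x y => `[< R x y >].

Lemma asbool_equiv_class : equiv_class_of r.
Proof.
split=> [x|x y|y x z]; first exact/asboolP.
  by apply/asboolP/asboolP; apply: Rsym.
by move=> /asboolP xy /asboolP yz; apply/asboolP; apply: Rtrans yz.
Qed.

Definition asbool_equiv : equiv_rel {classic U} :=
  EquivRelPack asbool_equiv_class.

Lemma asbool_equivP (x y : U) :
  \pi_({eq_quot asbool_equiv}) x = \pi_({eq_quot asbool_equiv}) y <-> R x y.
Proof. by split=> [/eqmodP /asboolP|xy] //; apply/eqmodP/asboolP. Qed.

Lemma asbool_equiv_repr (x : U) : R (repr (\pi_({eq_quot asbool_equiv}) x)) x.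
Proof. by apply/asbool_equivP; rewrite reprK. Qed.

End ClassicalQuotient.

Section AU.
Variables (G : groupType) (T : algtype) (X : pA G T).
Let A : algebra T := X.
Let theta : G -> A -> option A := @act G T X.

Definition simU (p q : G * A) : Prop :=
  theta (q.1^-1 * p.1) p.2 = Some q.2.

Lemma simU_refl p : simU p p.
Proof. by rewrite /simU mulVg; apply: pact1 (pA_action (pAP X)) _. Qed.

Lemma simU_sym p q : simU p q -> simU q p.
Proof.
by move=> /(pactK (pA_action (pAP X))); rewrite /simU invgM invgK.
Qed.

Lemma simU_trans p q r : simU p q -> simU q r -> simU p r.
Proof.
move=> pq /(pactM (pA_action (pAP X)) pq).
by rewrite /simU -mulgA mulVKg.
Qed.

Definition AU : Type := {eq_quot asbool_equiv simU_refl simU_sym simU_trans}.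

Definition classU (x : G) (a : A) : AU :=
  \pi_({eq_quot asbool_equiv simU_refl simU_sym simU_trans}) (x, a).

Definition reprU (u : AU) : G * A := repr u.

Lemma classUP x a y b : classU x a = classU y b <-> theta (y^-1 * x) a = Some b.
Proof. exact: asbool_equivP. Qed.

Lemma reprUK u : classU (reprU u).1 (reprU u).2 = u.
Proof. by rewrite /classU -surjective_pairing; exact: reprK. Qed.

(* Maps on quotients are defined on chosen representatives; the lemmas
   [thetaUE], [opUE], [op_algWE] and [thetaWE] show that the choice is
   immaterial. *)
Definition thetaU (x : G) (u : AU) : AU :=
  classU (x * (reprU u).1) (reprU u).2.

Lemma thetaUE x y a : thetaU x (classU y a) = classU (x * y) a.
Proof.
rewrite /thetaU.
have := reprUK (classU y a); case: (reprU _) => t c /= /classUP ty.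
by apply/classUP; rewrite invgM -mulgA mulKg.
Qed.

Definition opU (s : symbol T) (u : 'I_(arity s) -> AU) : option AU :=
  if pselect (exists p : G * ('I_(arity s) -> A),
                u = fun i => classU p.1 (p.2 i)) is left h
  then let p := projT1 (cid h) in Some (classU p.1 (op p.2))
  else None.

Lemma opUE (s : symbol T) x (a : 'I_(arity s) -> A) :
  opU (fun i => classU x (a i)) = Some (classU x (op a)).
Proof.
rewrite /opU; case: pselect => [h|[]]; last by exists (x, a).
case: cid => -[y b] /= xy; congr Some; apply/classUP.
apply: (siso_hom (pA_iso (pAP X) _)) => i; apply/classUP.
by rewrite -[LHS]/((fun i => classU y (b i)) i) -xy.
Qed.

Lemma opU_None (s : symbol T) (u : 'I_(arity s) -> AU) :
  (forall x a, u <> fun i => classU x (a i)) -> opU u = None.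
Proof.
move=> h; rewrite /opU; case: pselect => // e; case: (e) => -[x a] /= /h [].
Qed.

Definition palgU : palgebra T := PAlgebra opU.

End AU.

Section Words.
Variable T : algtype.

Inductive word (C : Type) : Type :=
| Letter of C
| App (s : symbol T) of ('I_(arity s) -> word C).

Fixpoint map_word (C C' : Type) (f : C -> C') (w : word C) : word C' :=
  match w with
  | Letter c => Letter (f c)
  | App s ws => App (fun i => map_word f (ws i))
  end.

(* [all_some u] is [Some c] when [u i = Some (c i)] for every [i]. *)
Definition all_some (n : nat) (C : Type) (u : 'I_n -> option C) :
    option ('I_n -> C) :=
  if pselect (exists c : 'I_n -> C, forall i, u i = Some (c i)) is left h
  then Some (projT1 (cid h)) else None.

Lemma all_someP n C (u : 'I_n -> option C) c :
  all_some u = Some c <-> forall i, u i = Some (c i).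
Proof.
rewrite /all_some; case: pselect => [h|h]; last first.
  by split=> // uc; case: h; exists c.
case: cid => c' uc' /=; split=> [[<-] //|uc].
by congr Some; apply/funext => i; apply: Some_inj; rewrite -uc' -uc.
Qed.

Variable C : palgebra T.

Fixpoint value (w : word C) : option C :=
  match w with
  | Letter c => Some c
  | App s ws => obind (@pop T C s) (all_some (fun i => value (ws i)))
  end.

Inductive Theta : word C -> word C -> Prop :=
| Theta_value w w' c : value w = Some c -> value w' = Some c -> Theta w w'
| Theta_app s (ws ws' : 'I_(arity s) -> word C) :
    (forall i, Theta (ws i) (ws' i)) -> Theta (App ws) (App ws').

Lemma Theta_refl w : Theta w w.
Proof.
by elim: w => [c|s ws IH]; [apply: (@Theta_value _ _ c)|apply: Theta_app].
Qed.

Lemma Theta_sym w w' : Theta w w' -> Theta w' w.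
Proof.
by elim=> [? ? c wc w'c|s ws ws' _ IH]; [apply: Theta_value w'c wc|apply: Theta_app].
Qed.

Lemma Theta_valueE w w' : Theta w w' -> value w = value w'.
Proof.
elim=> [? ? c -> -> //|s ws ws' _ IH] /=.
by congr (obind _ (all_some _)); apply/funext.
Qed.

Lemma Theta_inv w w' : Theta w w' ->
  (exists2 c, value w = Some c & value w' = Some c) \/
  match w, w' with
  | App s ws, App s' ws' => exists e : s = s',
      forall i, Theta (ws i) (ws' (cast_ord (congr1 (@arity T) e) i))
  | _, _ => False
  end.
Proof.
case=> [u u' c uc u'c|s ws ws' ww']; first by left; exists c.
by right; exists erefl => i; rewrite cast_ord_id.
Qed.

Lemma Theta_trans w w' w'' : Theta w w' -> Theta w' w'' -> Theta w w''.
Proof.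
move=> ww'; elim: ww' w'' => [u u' c uc u'c|s ws ws' ww' IH] w'' w'w''.
  by apply: Theta_value uc _; rewrite -(Theta_valueE w'w'').
have [[c w'c w''c]|] := Theta_inv w'w''.
  by apply: Theta_value w''c; rewrite (Theta_valueE (Theta_app ww')).
case: w'' w'w'' => // s' ws'' _ [e]; case: _ / e ws'' => ws'' h.
by apply: Theta_app => i; apply: IH; rewrite -{2}(cast_ord_id erefl i); apply: h.
Qed.

Definition W : Type := {eq_quot asbool_equiv Theta_refl Theta_sym Theta_trans}.

Definition classW (w : word C) : W :=
  \pi_({eq_quot asbool_equiv Theta_refl Theta_sym Theta_trans}) w.

Definition reprW (u : W) : word C := repr u.

Lemma classWP w w' : classW w = classW w' <-> Theta w w'.
Proof. exact: asbool_equivP. Qed.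

Lemma reprWK u : classW (reprW u) = u.
Proof. exact: reprK. Qed.

Definition algW : algebra T :=
  Algebra (fun s (u : 'I_(arity s) -> W) => classW (App (fun i => reprW (u i)))).

Lemma op_algWE (s : symbol T) (ws : 'I_(arity s) -> word C) :
  op (a := algW) (fun i => classW (ws i)) = classW (App ws).
Proof. by apply/classWP/Theta_app => i; apply/classWP/reprWK. Qed.

End Words.

Section WAU.
Variables (G : groupType) (T : algtype) (X : pA G T).

Definition thetaW (x : G) (u : algW (palgU X)) : algW (palgU X) :=
  classW (C := palgU X) (map_word (@thetaU G T X x) (reprW u)).

Lemma opU_thetaU (s : symbol T) x (u : 'I_(arity s) -> AU X) v :
  opU u = Some v -> opU (fun i => thetaU x (u i)) = Some (thetaU x v).
Proof.
have [[[y a] ->]|h] :=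
  pselect (exists p : G * ('I_(arity s) -> X), u = fun i => classU p.1 (p.2 i)).
  rewrite opUE => -[<-]; rewrite thetaUE -opUE; congr opU.
  by apply/funext => i; rewrite thetaUE.
by rewrite opU_None // => y a e; apply: h; exists (y, a).
Qed.

Lemma value_map_word x (w : word T (palgU X)) v : value w = Some v ->
  value (C := palgU X) (map_word (@thetaU G T X x) w) = Some (thetaU x v).
Proof.
elim: w v => [c v [<-] //|s ws IH v] /=.
case E: (all_some _) => [c|//] /= cv; move/all_someP: E => wc.
have /all_someP -> /= : forall i,
    value (C := palgU X) (map_word (@thetaU G T X x) (ws i)) =
    Some (thetaU x (c i)) by move=> i; apply: IH.
exact: opU_thetaU.
Qed.

Lemma thetaWE x (w : word T (palgU X)) :
  thetaW x (classW w) = classW (C := palgU X) (map_word (@thetaU G T X x) w).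
Proof.
apply/classWP; have /classWP : classW (reprW (classW w)) = classW w := reprWK _.
move: (reprW (classW w)) => w0.
elim=> [u u' c uc u'c|s ws ws' _ IH] /=; last exact: (@Theta_app T (palgU X)).
apply: (@Theta_value T (palgU X)); first exact: value_map_word uc.
exact: value_map_word u'c.
Qed.

Definition WAU : algact G T :=
  @AlgAct G T (algW (palgU X)) (fun x u => Some (thetaW x u)).

Definition iotaU (a : X) : WAU :=
  classW (C := palgU X) (Letter T (classU 1 a)).

End WAU.

(* Main.v *)
Require Import Defs.
From mathcomp Require Import all_boot.
From mathcomp Require Import boolp.

(** Let [iota : X -> Y] be a morphism into an algebra with a global action.
    Since [Y] is total in both respects, [iota] propagates without obstruction:
    the class of [(x, a)] is forced to go to [x . iota a], and then a word
    over these classes is forced to go to its value in [Y].  This gives at most one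
    extension of [iota] to the words over [AU X]; it passes to the quotient
    because every identification made in forming [AU X] and [Theta] expresses
    an equality that already holds in [X] and that [iota] transports to [Y]:
    - [(x, a)] and [(y, b)] are identified when [y^-1 x a = b], and then
      [x . iota a = y . iota b] ([extend_classUE]);
    - a word with value [v] is identified with the letter [v], and operations
      in [AU X] are operations of [X] translated by some [x], which acts on [Y]
      by a homomorphism ([eval_value]).
    Hence [WAU X] is a reflection of [X] into global actions, for all morphisms
    and not only for globalizations ([extend_morphism], [extend_unique]).

    It remains that [iotaU X] is a globalization ([globalization_iotaU]), that
    is, that the quotient does not identify too much.  A letter has itself as
    value and [Theta] preserves values, so distinct letters stay distinct
    ([classW_Letter]); and the classes of [(x, a)] and [(1, b)] in [AU X] agree
    exactly when [x a] is defined and equal to [b] ([act_iotaUP]).  The latter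
    gives both the injectivity (case [x = 1]) and the condition on domains. *)

Section GlobalActions.
Local Set Implicit Arguments.
Local Unset Strict Implicit.
Local Open Scope group_scope.
Variables (G : groupType) (T : algtype).

(** * Global actions by endomorphisms *)

(** A total action by endomorphisms is automatically by automorphisms with full
    domains, the inverse of [g x] being [g x^-1]. *)
Lemma in_A_total (B : algebra T) (g : G -> B -> B) :
  (forall b, g 1 b = b) -> (forall x y b, g x (g y b) = g (x * y) b) ->
  (forall x s (b : 'I_(arity s) -> B), g x (op b) = op (fun i => g x (b i))) ->
  in_A (@AlgAct G T B (fun x b => Some (g x b))).
Proof.
move=> g1 gM gop.
have gK x b : g x (g x^-1 b) = b by rewrite gM mulgV g1.
have gVK x b : g x^-1 (g x b) = b by rewrite gM mulVg g1.
have domT x b : dom (fun x b => Some (g x b)) x b.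
  by exists (g x^-1 b); rewrite gK.
split; last by move=> x b; exists (g x b).
split=> [|x s a _|x]; last 1 first.
- split=> /= [a|a b _|a a' b [<-] [/(congr1 (g x^-1))]|b _|s a b ab].
  + by split=> _; [exists (g x a)|exact: domT].
  + exact: domT.
  + by rewrite !gVK.
  + by exists (g x^-1 b); rewrite gK.
  + by rewrite gop; congr (Some (op _)); apply/funext => i; case: (ab i).
- split=> /= [a|x a b [<-]|x y a b c [<-] [<-]]; first by rewrite g1.
    by rewrite gVK.
  by rewrite gM.
- exact: domT.
Qed.

Section GlobalObject.
Variables (Y : algact G T) (gY : in_A Y).

Definition global_act (x : G) (y : Y) : Y := projT1 (cid (proj2 gY x y)).

Lemma global_actE x y : act x y = Some (global_act x y).
Proof. by rewrite /global_act; case: cid. Qed.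

Lemma global_act_eq x y z : act x y = Some z -> global_act x y = z.
Proof. by rewrite global_actE => -[]. Qed.

Lemma global_act1 y : global_act 1 y = y.
Proof. exact/global_act_eq/(pact1 (pA_action (proj1 gY))). Qed.

Lemma global_actM x y z :
  global_act x (global_act y z) = global_act (x * y) z.
Proof.
apply/esym/global_act_eq.
exact: pactM (pA_action (proj1 gY)) _ _ _ _ _ (global_actE _ _) (global_actE _ _).
Qed.

Lemma global_act_op x s (a : 'I_(arity s) -> Y) :
  global_act x (op a) = op (fun i => global_act x (a i)).
Proof.
apply: global_act_eq; apply: siso_hom (pA_iso (proj1 gY) x) _ _ _ _ => i.
exact: global_actE.
Qed.

End GlobalObject.

Variable X : pA G T.

(** * The globalization *)

Lemma map_word_id C (f : C -> C) (w : word T C) :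
  (forall c, f c = c) -> map_word f w = w.
Proof.
move=> f1; elim: w => [c|s ws IH] /=; first by rewrite f1.
by congr App; apply/funext.
Qed.

Lemma map_word_comp C C' C'' (f : C' -> C'') (g : C -> C') (w : word T C) :
  map_word f (map_word g w) = map_word (f \o g) w.
Proof. by elim: w => [//|s ws IH] /=; congr App; apply/funext. Qed.

Lemma thetaU1 (u : AU X) : thetaU 1 u = u.
Proof. by rewrite -(reprUK u) thetaUE mul1g. Qed.

Lemma thetaUM x y (u : AU X) : thetaU x (thetaU y u) = thetaU (x * y) u.
Proof. by rewrite -(reprUK u) !thetaUE mulgA. Qed.

Lemma in_A_WAU : in_A (WAU X).
Proof.
apply: in_A_total => [u|x y u|x s u].
- by rewrite -(reprWK u) thetaWE map_word_id // => c; apply: thetaU1.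
- rewrite -(reprWK u) !thetaWE map_word_comp; congr (classW (map_word _ _)).
  by apply/funext => c; apply: thetaUM.
- rewrite -[u](_ : (fun i => classW (reprW (u i))) = u); last first.
    by apply/funext => i; apply: reprWK.
  rewrite op_algWE thetaWE [map_word _ _]/= -op_algWE; congr op.
  by apply/funext => i; rewrite thetaWE.
Qed.

Lemma thetaW_iotaU x (a : X) :
  thetaW x (iotaU a) = classW (C := palgU X) (Letter T (classU x a)).
Proof. by rewrite thetaWE /= thetaUE mulg1. Qed.

Lemma classW_Letter (C : palgebra T) (c d : C) :
  classW (Letter T c) = classW (Letter T d) <-> c = d.
Proof.
split=> [/classWP /Theta_valueE [] //|-> //].
Qed.

(** Both the injectivity of [iotaU] and the domain condition on globalizations
    are instances of this equivalence. *)
Lemma act_iotaUP x (a b : X) :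
  act x (iotaU a) = Some (iotaU b) <-> act x a = Some b.
Proof.
rewrite /= thetaW_iotaU; split=> [[/classW_Letter /classUP]|xab].
  by rewrite invg1 mul1g.
by congr Some; apply/classW_Letter/classUP; rewrite invg1 mul1g.
Qed.

Lemma morphism_iotaU : morphism (@iotaU G T X).
Proof.
split=> [s a|x a b]; last by move/act_iotaUP.
rewrite op_algWE; apply/classWP.
apply: (@Theta_value T (palgU X) _ _ (classU 1 (op a))) => //=.
have /all_someP -> /= : forall i,
  Some (classU 1 (a i)) = Some (classU 1 (a i)) by [].
exact: opUE.
Qed.

Lemma globalization_iotaU : globalization (@iotaU G T X).
Proof.
split=> [||a b ab|x a]; [exact: in_A_WAU|exact: morphism_iotaU| |].
  have : act 1 (iotaU a) = Some (iotaU b).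
    by rewrite -ab (pact1 (pA_action (proj1 in_A_WAU))).
  by move/act_iotaUP; rewrite (pact1 (pA_action (pAP X))) => -[].
by split=> -[b xab]; exists b; apply/act_iotaUP.
Qed.

(** * Extension of morphisms into global actions *)

Section Extension.
Variables (Y : algact G T) (iota : X -> Y).
Hypotheses (gY : in_A Y) (iotaM : morphism iota).

Definition extend_classU (u : AU X) : Y :=
  global_act gY (reprU u).1 (iota (reprU u).2).

(** Independence of the representative: if [y^-1 x a = b] in [X], then
    [y . iota b = y . (y^-1 x . iota a) = x . iota a]. *)
Lemma extend_classUE x a : extend_classU (classU x a) = global_act gY x (iota a).
Proof.
rewrite /extend_classU; have := reprUK (classU x a).
case: (reprU _) => y b /= /classUP /(mor_act iotaM) /(global_act_eq gY) <-.
by rewrite global_actM mulVKg.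
Qed.

Lemma extend_classU_act x u :
  extend_classU (thetaU x u) = global_act gY x (extend_classU u).
Proof. by rewrite -(reprUK u) thetaUE !extend_classUE global_actM. Qed.

(** Where an operation of [AU X] is defined, its arguments have a common first
    component [x], which can be moved out of the operation of [Y] because it
    acts there by a homomorphism. *)
Lemma extend_classU_op s (u : 'I_(arity s) -> AU X) v :
  opU u = Some v -> extend_classU v = op (fun i => extend_classU (u i)).
Proof.
have [[[x a] ->]|h] :=
  pselect (exists p : G * ('I_(arity s) -> X), u = fun i => classU p.1 (p.2 i)).
  rewrite opUE => -[<-]; rewrite extend_classUE (mor_hom iotaM) global_act_op.
  by congr op; apply/funext => i; rewrite extend_classUE.
by rewrite opU_None // => x a e; apply: h; exists (x, a).
Qed.

Fixpoint eval (w : word T (AU X)) : Y :=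
  match w with
  | Letter u => extend_classU u
  | App s ws => op (fun i => eval (ws i))
  end.

Lemma eval_value (w : word T (palgU X)) v :
  value w = Some v -> eval w = extend_classU v.
Proof.
elim: w v => [u v [<-] //|s ws IH v] /=.
case E: (all_some _) => [c|//] /= /extend_classU_op ->; move/all_someP: E => wc.
by congr op; apply/funext => i; apply: IH.
Qed.

Lemma eval_Theta (w w' : word T (palgU X)) : Theta w w' -> eval w = eval w'.
Proof.
elim=> [u u' c /eval_value -> /eval_value -> //|s ws ws' _ IH] /=.
by congr op; apply/funext.
Qed.

Lemma eval_act x w :
  eval (map_word (@thetaU G T X x) w) = global_act gY x (eval w).
Proof.
elim: w => [u|s ws IH] /=; first exact: extend_classU_act.
by rewrite global_act_op; congr op; apply/funext.
Qed.

Definition extend (u : WAU X) : Y := eval (reprW u).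

Lemma extendE (w : word T (palgU X)) : extend (classW w) = eval w.
Proof. by apply/eval_Theta/classWP/reprWK. Qed.

Lemma extend_morphism : morphism extend.
Proof.
split=> [s u|x u v [<-]]; first exact: extendE.
by rewrite extendE eval_act (global_actE gY).
Qed.

Lemma extend_iotaU : iota = extend \o @iotaU G T X.
Proof.
by apply/funext => a /=; rewrite extendE /= extend_classUE global_act1.
Qed.

(** [WAU X] is generated as an algebra by the translates under [G] of the
    image of [iotaU], on which a morphism is determined by its restriction. *)
Lemma extend_unique (kappa : WAU X -> Y) :
  morphism kappa -> iota = kappa \o @iotaU G T X -> extend = kappa.
Proof.
move=> kM kE; apply/funext => u; rewrite -(reprWK u) extendE.
elim: (reprW u) => [c|s ws IH] /=.
  rewrite -(reprUK c) extend_classUE -thetaW_iotaU kE /=.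
  exact/global_act_eq/(mor_act kM).
rewrite -op_algWE (mor_hom kM); congr op; exact/funext.
Qed.

End Extension.
End GlobalActions.

Theorem theorem3p16 (G : groupType) (T : algtype) (X : pA G T) :
  (exists (Y : algact G T) (iota : X -> Y), globalization iota) /\
  universal_globalization (@iotaU G T X).
Proof.
have gl := globalization_iotaU X.
split; first by exists (WAU X), (@iotaU G T X).
split=> // Y iota [gY iotaM _ _]; exists (extend iota gY).
split; first by split; [apply: extend_morphism|apply: extend_iotaU].
by move=> kappa [kM kE]; apply: extend_unique.
Qed.
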